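(* Let $f_1,\dots,f_n:\mathbb R^d\to\mathbb R$ be differentiable and $f=\frac1n\sum_{i=1}^nf_i$. Assume that $f$ is $L$-smooth ($\|\nabla f(x)-\nabla f(y)\|\le L\|x-y\|$ for all $x,y$), that $f(x)\ge f^*$ for all $x$ for some $f^*\in\mathbb R$, and that the Functional $(L_A,L_B)$ Inequality holds for $f_1,\dots,f_n$. Suppose that for every $t\ge 0$ we have $\{\mathcal C_i^t\}_{i=1}^n\in\mathbb P(\theta)$ and $\mathcal C_i^t\in\mathbb U(\omega_P)$ for all $i\in[n]$. Consider MARINA-P with probability $p\in(0,1]$ and a step size satisfying $$0<\gamma\le\frac{1}{L+\sqrt{(L_A^2\omega_P+L_B^2\theta)\left(\frac1p-1\right)}}.$$ Let $$\Psi^t=f(x^t)-f^*+\frac{\gamma L_A^2}{2p}\,\frac1n\sum_{i=1}^n\|w_i^t-x^t\|^2+\frac{\gamma L_B^2}{2p}\|w^t-x^t\|^2 .$$ Then for each integer $T\ge1$, $$\frac1T\sum_{t=0}^{T-1}\mathbb E\left[\|\nabla f(x^t)\|^2\right]\le\frac{2\Psi^0}{\gamma T}.$$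
   Context: $\|\cdot\|$ is the Euclidean norm. Functional $(L_A,L_B)$ Inequality ($L_A,L_B\ge0$): for all $x,u_1,\dots,u_n\in\mathbb R^d$, $\|\frac1n\sum_{i=1}^n(\nabla f_i(x+u_i)-\nabla f_i(x))\|^2\le L_A^2(\frac1n\sum_{i=1}^n\|u_i\|^2)+L_B^2\|\frac1n\sum_{i=1}^nu_i\|^2$. Compressors: a random mapping $\mathcal C:\mathbb R^d\to\mathbb R^d$ is in $\mathbb U(\omega)$ if $\mathbb E[\mathcal C(x)]=x$ and $\mathbb E\|\mathcal C(x)-x\|^2\le\omega\|x\|^2$ for all $x$. A collection of random mappings $\{\mathcal C_i\}_{i=1}^n$ is in $\mathbb P(\theta)$ if $\mathbb E[\mathcal C_i(x)]=x$ for all $i$ and $\mathbb E\|\frac1n\sum_{i=1}^n\mathcal C_i(x)-x\|^2\le\theta\|x\|^2$ for all $x$. MARINA-P: given $x^0,w_1^0,\dots,w_n^0\in\mathbb R^d$, $\gamma>0$, $p\in(0,1]$ and compressors $\mathcal C_i^t$, for $t=0,1,\dots$: $g^t=\frac1n\sum_{i=1}^n\nabla f_i(w_i^t)$; $x^{t+1}=x^t-\gamma g^t$; draw $c^t\sim\mathrm{Bernoulli}(p)$ (one coin for all workers); for all $i\in[n]$, $w_i^{t+1}=x^{t+1}$ if $c^t=1$ and $w_i^{t+1}=w_i^t+\mathcal C_i^t(x^{t+1}-x^t)$ if $c^t=0$. Denote $w^t=\frac1n\sum_{i=1}^nw_i^t$. The compressors' randomness is independent across iterations (not necessarily across $i$),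 and the coins are independent of each other and of the compressors. *)

(* Defs.v *)
From HB Require Import structures.
From mathcomp Require Import all_boot all_order all_algebra.
From mathcomp Require Import all_classical all_reals all_analysis.

Set Implicit Arguments.
Unset Strict Implicit.
Unset Printing Implicit Defensive.

Import Order.TTheory GRing.Theory Num.Theory.
Import numFieldNormedType.Exports.

Local Open Scope classical_set_scope.
Local Open Scope ring_scope.

(* The Borel sigma-algebra of R^m, generated by the coordinate projections;
   same construction as the library's instance on n.-tuple T. *)
Definition rV_display : measure_display. Proof. exact: default_measure_display. Qed.

Section measurable_rV.
Context {R : realType} (m : nat).

Let coord : 'I_m -> 'rV[R]_m -> R := fun j u => u 0 j.

Let rV_set0 : g_sigma_preimage coord set0.
Proof. exact: sigma_algebra0. Qed.

Let rV_setC A : g_sigma_preimage coord A -> g_sigma_preimage coord (~` A).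
Proof. exact: sigma_algebraC. Qed.

Let rV_bigcup (F : _^nat) : (forall k, g_sigma_preimage coord (F k)) ->
  g_sigma_preimage coord (\bigcup_k F k).
Proof. exact: sigma_algebra_bigcup. Qed.

HB.instance Definition _ := @isMeasurable.Build rV_display
  'rV[R]_m (g_sigma_preimage coord) rV_set0 rV_setC rV_bigcup.

End measurable_rV.

Section euclidean.
Context {R : realType} {m : nat}.
Implicit Types (f : 'rV[R]_m -> R) (x u : 'rV[R]_m).

(* The library norm `|u| on matrices is the sup norm. *)
Definition enorm u : R := Num.sqrt (\sum_j u 0 j ^+ 2).

Definition grad f x : 'rV[R]_m := \row_j 'D_(delta_mx 0 j) f x.

Definition smooth (L : R) f :=
  forall x y, enorm (grad f x - grad f y) <= L * enorm (x - y).

End euclidean.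

Section average.
Context {R : realType} {n : nat} {V : lmodType R}.

Definition avg (a : 'I_n -> V) : V := n%:R^-1 *: \sum_i a i.

End average.

Definition functional_inequality {R : realType} {m n : nat} (LA LB : R)
    (f : 'I_n -> 'rV[R]_m -> R) :=
  forall (x : 'rV[R]_m) (u : 'I_n -> 'rV[R]_m),
    enorm (avg (fun i => grad (f i) (x + u i) - grad (f i) x)) ^+ 2 <=
    LA ^+ 2 * avg (fun i => enorm (u i) ^+ 2 : R^o) + LB ^+ 2 * enorm (avg u) ^+ 2.

Section randomness.
Context {d : measure_display} {T : measurableType d} {R : realType}.
Variable P : probability T R.

Definition mutually_independent (I : eqType) (F : I -> set (set T)) :=
  forall (s : seq I) (A : I -> set T), uniq s ->
    (forall i, i \in s -> F i (A i)) ->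
    P (\bigcap_(i in [set` s]) A i) = (\prod_(i <- s) P (A i))%E.

Context {m : nat}.
Local Notation V := 'rV[R]_m.

(* A finite value of the extended-real expectation of a measurable function
   forces integrability. *)
Definition has_mean (X : T -> V) (x : V) :=
  forall j, 'E_P[fun w => X w 0%R j]%E = (x 0 j)%:E.

(* C is a random mapping whose randomness is carried by the random element xi:
   C w v = Q (xi w) v.  Joint measurability of Q makes C w (X w) a random
   vector whenever X is one; measurability of C ^~ v for each v would not, and
   independence of the values C ^~ v alone would not allow conditioning on a
   random argument. *)
Definition random_mapping {d'} {S : measurableType d'} (xi : T -> S)
    (C : T -> V -> V) :=
  exists2 Q : S -> V -> V,
    measurable_fun [set: S * V] (fun z => Q z.1 z.2) &
    forall w v, C w v = Q (xi w) v.

Definition compressor_U (omega : R) (C : T -> V -> V) :=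
  forall x, has_mean (C ^~ x) x /\
    ('E_P[fun w => (enorm (C w x - x) ^+ 2)%R] <= (omega * enorm x ^+ 2)%:E)%E.

Definition compressors_P {n : nat} (theta : R) (C : 'I_n -> T -> V -> V) :=
  forall x, (forall i, has_mean (C i ^~ x) x) /\
    ('E_P[fun w => (enorm (avg (fun i => C i w x) - x) ^+ 2)%R] <=
       (theta * enorm x ^+ 2)%:E)%E.

End randomness.

Section marinaP.
Context {R : realType} {m n : nat}.
Local Notation V := 'rV[R]_m.
Variables (f : 'I_n -> V -> R) (gamma : R).

(* The run, for fixed outcomes of the compressors and of the coins; the state
   after t iterations is (x^t, (w_i^t)_i). *)
Fixpoint marinaP (x0 : V) (w0 : 'I_n -> V) (C : nat -> 'I_n -> V -> V)
    (c : nat -> bool) (t : nat) : V * ('I_n -> V) :=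
  if t is t'.+1 then
    let: (x, w) := marinaP x0 w0 C c t' in
    let g := avg (fun i => grad (f i) (w i)) in
    let x' := x - gamma *: g in
    (x', fun i => if c t' then x' else w i + C t' i (x' - x))
  else (x0, w0).

Definition lyapunov (fstar LA LB p : R) (xw : V * ('I_n -> V)) : R :=
  let: (x, w) := xw in
  avg (fun i => f i x : R^o) - fstar
  + gamma * LA ^+ 2 / (2 * p) * avg (fun i => enorm (w i - x) ^+ 2 : R^o)
  + gamma * LB ^+ 2 / (2 * p) * enorm (avg w - x) ^+ 2.

End marinaP.

(* Main.v *)
Require Import Defs.
From HB Require Import structures.
From mathcomp Require Import all_boot all_order all_algebra.
From mathcomp Require Import all_classical all_reals all_analysis.
From mathcomp Require Import measurable_realfun ring lra.

(* For a fixed state (x, w), the L-smooth descent inequality for f, with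
   g = avg (grad f_i (w_i)) and x' = x - gamma g, gives
     f x' + gamma/2 |grad f x|^2 + (1/gamma - L)/2 |x' - x|^2
       <= f x + gamma/2 |g - grad f x|^2,
   and the functional inequality bounds |g - grad f x|^2 by the drift
   LA^2 avg |w_i - x|^2 + LB^2 |avg w - x|^2.  The drift vanishes after a
   synchronisation and otherwise grows on average by at most
   (LA^2 omega + LB^2 theta) |x' - x|^2, the compressors being unbiased.  With
   weight gamma/(2p) on the drift, the step size condition makes the
   |x' - x|^2 terms cancel, so the Lyapunov function drops on average by
   gamma/2 |grad f x|^2, and the sum telescopes.
   Integrability of the iterates is never needed: all quantities are nonnegative,
   and the one-round bound, pointwise in the state, is integrated by Tonelli.
   This requires the state at time t to be independent of the draws at time t,
   which is obtained by induction, keeping independence from all later draws. *)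

Set Implicit Arguments.
Unset Strict Implicit.
Unset Printing Implicit Defensive.

Import Order.TTheory GRing.Theory Num.Theory.
Import numFieldNormedType.Exports.

Local Open Scope classical_set_scope.
Local Open Scope ring_scope.

(** * Euclidean inner product, gradients and the descent inequality *)

Section euclidean_space.
Context {R : realType} {m : nat}.
Implicit Types (u v x y : 'rV[R]_m) (f : 'rV[R]_m -> R).

Definition dotv u v : R := \sum_j u 0 j * v 0 j.

Lemma enorm_sqr u : enorm u ^+ 2 = dotv u u.
Proof.
rewrite sqr_sqrtr; first by apply: eq_bigr => j _; rewrite expr2.
by apply: sumr_ge0 => j _; exact: sqr_ge0.
Qed.

Lemma enorm_ge0 u : 0 <= enorm u.
Proof. exact: sqrtr_ge0. Qed.

Lemma enorm0 : enorm (0 : 'rV[R]_m) = 0.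
Proof. by rewrite /enorm big1 ?sqrtr0// => j _; rewrite mxE expr0n. Qed.

Lemma dotvC u v : dotv u v = dotv v u.
Proof. by apply: eq_bigr => j _; rewrite mulrC. Qed.

Lemma dotvDl u v x : dotv (u + v) x = dotv u x + dotv v x.
Proof. by rewrite -big_split; apply: eq_bigr => j _; rewrite mxE mulrDl. Qed.

Lemma dotvZl a u v : dotv (a *: u) v = a * dotv u v.
Proof. by rewrite mulr_sumr; apply: eq_bigr => j _; rewrite mxE mulrA. Qed.

Lemma dotvDr u v x : dotv x (u + v) = dotv x u + dotv x v.
Proof. by rewrite dotvC dotvDl !(dotvC x). Qed.

Lemma dotvZr a u v : dotv u (a *: v) = a * dotv u v.
Proof. by rewrite dotvC dotvZl dotvC. Qed.

Lemma dotvNl u v : dotv (- u) v = - dotv u v.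
Proof. by rewrite -scaleN1r dotvZl mulN1r. Qed.

Lemma dotvNr u v : dotv u (- v) = - dotv u v.
Proof. by rewrite dotvC dotvNl dotvC. Qed.

Lemma dotv0 u : dotv u 0 = 0.
Proof. by rewrite -(scale0r (0 : 'rV[R]_m)) dotvZr mul0r. Qed.

Lemma enorm_sqrD u v :
  enorm (u + v) ^+ 2 = enorm u ^+ 2 + 2 * dotv u v + enorm v ^+ 2.
Proof. by rewrite !enorm_sqr dotvDl !dotvDr (dotvC v u); ring. Qed.

Lemma enorm_sqrZ a u : enorm (a *: u) ^+ 2 = a ^+ 2 * enorm u ^+ 2.
Proof. by rewrite !enorm_sqr dotvZl dotvZr mulrA expr2. Qed.

Lemma enormZ a u : 0 <= a -> enorm (a *: u) = a * enorm u.
Proof.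
move=> a0; apply/eqP; rewrite -(@eqrXn2 _ 2)//; first by rewrite exprMn enorm_sqrZ.
- exact: enorm_ge0.
- by rewrite mulr_ge0 ?enorm_ge0.
Qed.

Lemma enormN u : enorm (- u) = enorm u.
Proof. by congr Num.sqrt; apply: eq_bigr => j _; rewrite mxE sqrrN. Qed.

Lemma enorm_sqr_eq0 u : enorm u ^+ 2 = 0 -> u = 0.
Proof.
rewrite enorm_sqr => /eqP; rewrite psumr_eq0; last first.
  by move=> j _; rewrite -expr2 sqr_ge0.
move=> /allP u0; apply/rowP => j; rewrite mxE.
by have /implyP/(_ isT) := u0 j (mem_index_enum j); rewrite mulf_eq0 orbb => /eqP.
Qed.

(** Takes the place of Cauchy-Schwarz: expand [0 <= |u - c v|^2], bound [|u|^2] by [c^2 |v|^2] and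
    divide by [2 c]. When [c = 0] the hypothesis forces [u = 0]. *)
Lemma dotv_le_enorm (c : R) u v :
  0 <= c -> enorm u <= c * enorm v -> dotv u v <= c * enorm v ^+ 2.
Proof.
move=> c0 uv.
have uv2 : enorm u ^+ 2 <= c ^+ 2 * enorm v ^+ 2.
  by rewrite -exprMn lerXn2r// nnegrE ?mulr_ge0// enorm_ge0.
have [c0E|cN0] := eqVneq c 0.
  have -> : u = 0.
    apply: enorm_sqr_eq0; apply/eqP; rewrite eq_le sqr_ge0 andbT.
    by rewrite (le_trans uv2)// c0E expr0n mul0r.
  by rewrite dotvC dotv0 c0E mul0r.
have c_gt0 : 0 < c by rewrite lt_neqAle eq_sym cN0.
have := sqr_ge0 (enorm (u - c *: v)).
rewrite enorm_sqrD enormN enorm_sqrZ dotvNr dotvZr => h.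
by rewrite -(ler_pM2l c_gt0); nra.
Qed.

Lemma derive_dotv f x v : differentiable f x -> 'D_v f x = dotv (grad f x) v.
Proof.
move=> fx; rewrite deriveE//.
rewrite {1}(row_sum_delta v) linear_sum; apply: eq_bigr => j _.
by rewrite linearZ/= mxE deriveE// mulrC.
Qed.

(** The difference quotient of the restriction to the line, at [s], is literally that of [f] at
    [s *: v + x] in direction [v]. *)
Lemma is_derive_line f x v (s : R) : differentiable f (s *: v + x) ->
  is_derive s 1 (fun h => f (h *: v + x)) ('D_v f (s *: v + x)).
Proof.
move=> fx.
have E : (fun h : R => h^-1 *: (f ((h *: 1 + s) *: v + x) - f (s *: v + x))) =
  (fun h => h^-1 *: (f (h *: v + (s *: v + x)) - f (s *: v + x))).
  by apply/funext => h; rewrite [h *: 1]mulr1 scalerDl addrA.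
apply: DeriveDef; last by rewrite /derive /= E.
by have := @diff_derivable _ _ _ f _ v fx; rewrite /derivable /= E.
Qed.

(** The mean value theorem replaces the usual integral along the segment. Subtracting the claimed
    quadratic bound from [f] on the line leaves [phi], whose derivative is nonpositive at the
    intermediate point, so that [phi 1 <= phi 0]. *)
Lemma descent (L : R) f x y : (forall z, differentiable f z) -> smooth L f ->
  0 <= L ->
  f y <= f x + dotv (grad f x) (y - x) + L / 2 * enorm (y - x) ^+ 2.
Proof.
move=> df sf L0; set v := y - x; set a := dotv _ _; set b := L / 2 * _.
pose phi := (fun h : R => f (h *: v + x)) - (a \*: id) - (b \*: (id ^+ 2)) : R -> R.
have dphi (s : R) : is_derive s (1 : R) phi ('D_v f (s *: v + x) - a - 2 * b * s).
  have dl := is_derive_line (df (s *: v + x)).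
  apply: is_derive_eq.
  by rewrite ![_ *: 1]mulr1 /= expr1 /GRing.scale/= ; ring.
have cphi : {within `[(0:R), 1], continuous phi}.
  apply: continuous_subspaceT => s; apply: differentiable_continuous.
  by apply/derivable1_diffP; case: (dphi s).
have [c /[!in_itv]/= /andP[c0 c1]] := MVT ltr01 (fun s _ => dphi s) cphi.
rewrite subr0 mulr1 /phi /=.
have phiE h : phi h = f (h *: v + x) - a * h - b * h ^+ 2 by [].
rewrite -/(phi 1) -/(phi 0) !phiE scale1r scale0r add0r subrK derive_dotv//.
(* The intermediate point is at distance [c |v|] from [x], so the gradient changes by at most
   [L c |v|]; the resulting [L c |v|^2] is exactly the slope [2 b c] of the quadratic term. *)
have := @dotv_le_enorm (L * c) (grad f (c *: v + x) - grad f x) v.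
rewrite dotvDl dotvNl -/a mulr_ge0 ?(ltW c0)//= => /(_ isT).
have -> : enorm (grad f (c *: v + x) - grad f x) <= L * c * enorm v.
  by rewrite (le_trans (sf _ _))// addrK enormZ ?(ltW c0)// mulrA.
have : 2 * b * c = L * c * enorm v ^+ 2 by rewrite /b; field.
by move=> -> /(_ isT) ? ?; lra.
Qed.
End euclidean_space.

(** * Averages over the workers *)

Section average_lemmas.
Context {R : realType} {n : nat}.

Lemma avgB {V : lmodType R} (a b : 'I_n -> V) :
  avg (fun i => a i - b i) = avg a - avg b.
Proof. by rewrite /avg sumrB scalerBr. Qed.

Lemma avgD {V : lmodType R} (a b : 'I_n -> V) :
  avg (fun i => a i + b i) = avg a + avg b.
Proof. by rewrite /avg big_split scalerDr. Qed.

Lemma avg_cst {V : lmodType R} (v : V) : (0 < n)%N ->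
  avg (fun _ : 'I_n => v) = v.
Proof.
move=> n0; rewrite /avg sumr_const card_ord -[v *+ n]scaler_nat scalerA mulVf ?scale1r//.
by rewrite pnatr_eq0 -lt0n.
Qed.

Lemma avg_ge0 (a : 'I_n -> R) : (forall i, 0 <= a i) -> 0 <= avg (a : 'I_n -> R^o).
Proof. by move=> a0; rewrite mulr_ge0 ?invr_ge0// sumr_ge0. Qed.

Lemma avg_coord {m : nat} (a : 'I_n -> 'rV[R]_m) i j :
  avg a i j = n%:R^-1 * \sum_k a k i j.
Proof. by rewrite mxE summxE. Qed.

Lemma differentiable_avg {m : nat} (f_ : 'I_n -> 'rV[R]_m -> R) x :
  (forall i, differentiable (f_ i) x) ->
  differentiable (fun z => avg (fun i => f_ i z : R^o)) x.
Proof.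
move=> df; have -> : (fun z => avg (fun i => f_ i z : R^o)) =
    n%:R^-1 \*: \sum_i f_ i :> (_ -> R).
  by apply/funext => z; rewrite /= fct_sumE.
by apply: differentiableZ; apply: differentiable_sum.
Qed.

Lemma grad_avg {m : nat} (f_ : 'I_n -> 'rV[R]_m -> R) x :
  (forall i, differentiable (f_ i) x) ->
  grad (fun z => avg (fun i => f_ i z : R^o)) x = avg (fun i => grad (f_ i) x).
Proof.
move=> df; apply/rowP => j; rewrite avg_coord mxE.
have -> : (fun z => avg (fun i => f_ i z : R^o)) =
    n%:R^-1 \*: \sum_i f_ i :> (_ -> R).
  by apply/funext => z; rewrite /= fct_sumE.
rewrite deriveZ; last first.
  by apply: derivable_sum => i; exact: diff_derivable.
rewrite derive_sum; last by move=> i; exact: diff_derivable.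
by congr (_ * _); apply: eq_bigr => i _; rewrite mxE.
Qed.

End average_lemmas.

(** With [s] the square root of [K], the condition reads [gamma L + gamma s <= 1]; hence
    [gamma s <= 1] and [(gamma s)^2 <= gamma s <= 1 - gamma L]. A negative [K] has square root 0 and
    only helps. *)
Lemma stepsize_bound {R : realType} (L K gamma : R) : 0 <= L -> 0 < gamma ->
  (gamma%:E <= 1 / (L + Num.sqrt K)%:E)%E -> gamma ^+ 2 * K <= 1 - gamma * L.
Proof.
move=> L0 g0 h; set s := Num.sqrt K in h.
have s0 : 0 <= s by exact: sqrtr_ge0.
have Ks : K <= s ^+ 2.
  have [K0|K0] := leP 0 K; first by rewrite sqr_sqrtr.
  by rewrite (le_trans (ltW K0)) ?sqr_ge0.
have {}h : gamma * (L + s) <= 1.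
  (* A zero denominator makes the extended-real quotient infinite, but then the product is 0. *)
  have [->|LsN0] := eqVneq (L + s) 0; first by rewrite mulr0.
  rewrite inver (negbTE LsN0) mul1e lee_fin in h.
  by rewrite -ler_pdivlMr ?div1r// lt_neqAle eq_sym LsN0 addr_ge0.
have gs0 : 0 <= gamma * s by rewrite mulr_ge0// ltW.
have gL0 : 0 <= gamma * L by rewrite mulr_ge0// ltW.
apply: (@le_trans _ _ ((gamma * s) ^+ 2)).
  by rewrite exprMn ler_pM2l// exprn_gt0.
by nra.
Qed.

(** * The one-round inequality at a fixed state *)

Section marinaP_step.
Context {R : realType} {m n : nat}.
Local Notation V := 'rV[R]_m.
Variables (f_ : 'I_n -> V -> R) (L LA LB fstar gamma p omega theta : R).
Let f (x : V) : R := avg (fun i => f_ i x : R^o).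
Hypothesis n_gt0 : (0 < n)%N.
Hypothesis df : forall i x, differentiable (f_ i) x.
Hypothesis smooth_f : smooth L f.
Hypothesis functional : functional_inequality LA LB f_.
Hypothesis gamma_gt0 : 0 < gamma.
Hypothesis p01 : 0 < p <= 1.
Hypothesis step : (gamma%:E <= 1 / (L +
  Num.sqrt ((LA ^+ 2 * omega + LB ^+ 2 * theta) * (1 / p - 1)))%:E)%E.

Definition next_x (xw : V * ('I_n -> V)) : V :=
  xw.1 - gamma *: avg (fun i => grad (f_ i) (xw.2 i)).

Definition drift (xw : V * ('I_n -> V)) : R :=
  LA ^+ 2 * avg (fun i => enorm (xw.2 i - xw.1) ^+ 2 : R^o) +
  LB ^+ 2 * enorm (avg xw.2 - xw.1) ^+ 2.

Lemma lyapunovE xw : lyapunov f_ gamma fstar LA LB p xw =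
  f xw.1 - fstar + gamma / (2 * p) * drift xw.
Proof. by case: xw => x w; rewrite /lyapunov /drift /f/=; lra. Qed.

Lemma drift_diag x : drift (x, fun=> x) = 0.
Proof.
by rewrite /drift/= !avg_cst// subrr enorm0 expr0n/= !mulr0 addr0.
Qed.

(** The coin appears through its weights [p] and [1 - p]. In the compressed branch the drift is
    replaced by the bound on its mean that [expected_drift] establishes later, so no probability
    enters here. *)
Lemma lyapunov_step_bound (xw : V * ('I_n -> V)) :
  p * lyapunov f_ gamma fstar LA LB p (next_x xw, fun=> next_x xw) +
  (1 - p) * (f (next_x xw) - fstar + gamma / (2 * p) * (drift xw +
    (LA ^+ 2 * omega + LB ^+ 2 * theta) * enorm (next_x xw - xw.1) ^+ 2)) +
  gamma / 2 * enorm (grad f xw.1) ^+ 2 <=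
  lyapunov f_ gamma fstar LA LB p xw.
Proof.
case: xw => x w; set x' := next_x _; rewrite !lyapunovE drift_diag /=.
set D := enorm (x' - x) ^+ 2.
set K := LA ^+ 2 * omega + _.
set g := avg (fun i => grad (f_ i) (w i)).
have gradE z : grad f z = avg (fun i => grad (f_ i) z) by exact: grad_avg.
(* The functional inequality at [x] with displacements [w i - x]. *)
have grad_drift : enorm (g - grad f x) ^+ 2 <= drift (x, w).
  have := functional x (fun i => w i - x); rewrite avgB avgB !avg_cst// -gradE.
  rewrite (_ : (fun i => _) = fun i => grad (f_ i) (w i))//.
  by apply/funext => i; rewrite addrC subrK.
have gxE : x' - x = - (gamma *: g) by rewrite addrAC subrr add0r.
have DE : D = gamma ^+ 2 * enorm g ^+ 2 by rewrite /D gxE enormN enorm_sqrZ.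
have D0 : 0 <= D by exact: sqr_ge0.
(* Smoothness yields [0 <= L] only from two distinct points. If [x' = x], then [D = 0] and the
   estimates below are immediate. *)
have L_ge0 : x' = x \/ 0 <= L.
  have [xE|xN] := eqVneq x' x; [by left|right].
  have e0 : 0 < enorm (x' - x).
    rewrite lt_neqAle enorm_ge0 andbT eq_sym; apply: contra_neq xN => e0.
    by apply/eqP; rewrite -subr_eq0; apply/eqP/enorm_sqr_eq0; rewrite e0 expr0n.
  have := le_trans (enorm_ge0 _) (smooth_f x' x).
  by rewrite pmulr_lge0.
have f_le : f x' <= f x - gamma * dotv (grad f x) g + L / 2 * D.
  case: L_ge0 => [xE|L0].
    have gg : gamma *: g = 0 by apply/eqP; rewrite -oppr_eq0 -gxE xE subrr.
    rewrite /D xE subrr enorm0 expr0n mulr0 addr0.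
    by rewrite -dotvZr gg dotv0 subr0.
  have := @descent R m L f x x' _ smooth_f L0.
  rewrite {1}gxE dotvNr dotvZr; apply => z; exact: differentiable_avg.
have KD : gamma ^+ 2 * (K * (1 / p - 1)) * D <= (1 - gamma * L) * D.
  case: L_ge0 => [xE|L0].
    by rewrite /D xE subrr enorm0 expr0n !mulr0.
  by rewrite ler_wpM2r//; exact: stepsize_bound.
have := enorm_sqrD g (- grad f x); rewrite enormN dotvNr dotvC => gE.
rewrite gE in grad_drift; move: grad_drift gE DE KD f_le.
set dg := dotv _ _; set eg := enorm g ^+ 2; set ef := enorm (grad f x) ^+ 2.
set q := drift _; move=> grad_drift _ DE KD f_le.
set c := K * (1 / p - 1) in KD; set k := gamma / (2 * p).
have p_gt0 : 0 < p by case/andP: p01.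
(* This equality dictates the weight [k]: the fraction [p] of the drift erased by synchronisation
   pays exactly for the gradient error, whose coefficient is [gamma / 2]. *)
have kE : gamma / 2 = p * k by rewrite /k; field; rewrite gt_eqF.
have cE : (1 - p) * K = p * c by rewrite /c; field; rewrite gt_eqF.
(* The step size bound divided by [gamma], using [D = gamma^2 eg]. *)
have cD : gamma * (c * D) <= gamma * eg - L * D.
  by rewrite -(ler_pM2l gamma_gt0); lra.
clearbody k c.
have -> : (1 - p) * (f x' - fstar + k * (q + K * D)) =
    (1 - p) * (f x' - fstar) + (k - p * k) * q + p * k * (c * D).
  have -> : p * k * (c * D) = p * c * (k * D) by ring.
  by rewrite -cE; ring.
have g2 : 0 <= gamma / 2 by rewrite divr_ge0// ltW.
have := ler_wpM2l g2 grad_drift.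
by rewrite -kE; lra.
Qed.
End marinaP_step.

(** * Measurability on the row space: open sets, continuous functions, gradients *)

Section measurability.
Context {R : realType} {m : nat}.
Local Notation V := 'rV[R]_m.

Lemma bigcup_countType_measurable d (T : measurableType d) (I : countType)
  (F : I -> set T) : (forall i, measurable (F i)) -> measurable (\bigcup_i F i).
Proof.
move=> mF; have -> : \bigcup_i F i =
    \bigcup_k (if unpickle k is Some i then F i else set0).
  apply/seteqP; split=> [x [i _ Fix]|x [k _]].
    by exists (pickle i) => //; rewrite pickleK.
  by case: unpickle => // i Fix; exists i.
by apply: bigcupT_measurable => k; case: unpickle.
Qed.

Lemma measurable_coord (j : 'I_m) : measurable_fun [set: V] (fun u => u 0 j).
Proof.
move=> _ Y mY; rewrite setTI; apply: sub_sigma_algebra => /=.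
rewrite -bigcup_seq/=; exists j => /=; first by rewrite mem_index_enum.
by exists Y => //; rewrite setTI.
Qed.

(** The sets with measurable preimage form a sigma-algebra containing the generators. *)
Lemma measurable_fun_rV d (T : measurableType d) (g : T -> V) :
  (forall j, measurable_fun setT (fun t => g t 0 j)) -> measurable_fun setT g.
Proof.
move=> mg.
have h : g_sigma_preimage (fun (j : 'I_m) (u : V) => u 0 j) `<=`
    [set A | measurable (g @^-1` A)].
  apply: smallest_sub.
    split => [|A mA|F mF] /=.
    - by rewrite preimage_set0.
    - by rewrite setTD preimage_setC; exact: measurableC.
    - by rewrite preimage_bigcup; exact: bigcupT_measurable.
  rewrite -bigcup_seq => A [j _ [B mB <-]] /=.
  by rewrite setTI -[X in measurable X]setTI; exact: mg.
by move=> _ A mA; rewrite setTI; exact: h.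
Qed.

(** Links the coordinate sigma-algebra to the topology: an open set is the countable union of the
    boxes with rational corners that it contains. *)
Lemma open_rV_measurable (O : set V) : open O -> measurable O.
Proof.
move=> oO; pose box (ab : 'rV[rat]_m * 'rV[rat]_m) : set V :=
  \bigcap_(j : 'I_m) [set x | ratr (ab.1 0 j) < x 0 j < ratr (ab.2 0 j)].
have mbox ab : measurable (box ab).
  apply: fin_bigcap_measurable => // j _.
  have := @measurable_coord j measurableT _
    (measurable_itv `]ratr (ab.1 0 j), ratr (ab.2 0 j)[).
  by rewrite setTI (_ : _ @^-1` _ =
    [set x : V | ratr (ab.1 0 j) < x 0 j < ratr (ab.2 0 j)])//.
have -> : O = \bigcup_ab (if `[< box ab `<=` O >] then box ab else set0).
  apply/seteqP; split => [x Ox|x [ab _]]; last by case: asboolP => [ab_O|_ []]; exact: ab_O.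
  have /nbhs_ballP[e /= e0 xeO] := open_nbhs_nbhs (conj oO Ox).
  have ha j : exists q : rat, x 0 j - e < ratr q < x 0 j.
    have : x 0 j - e < x 0 j by rewrite ltrBlDr ltrDl.
    by move=> /rat_in_itvoo[q]; rewrite in_itv; exists q.
  have hb j : exists q : rat, x 0 j < ratr q < x 0 j + e.
    have : x 0 j < x 0 j + e by rewrite ltrDl.
    by move=> /rat_in_itvoo[q]; rewrite in_itv; exists q.
  have {ha}[a ha] := choice ha; have {hb}[b hb] := choice hb.
  (* The corners lie within [e] of [x] on either side, so the box sits in the sup-norm ball of
     radius [e]. *)
  exists (\row_j a j, \row_j b j) => //.
  case: asboolP => [_ j _|[]] /=.
    by rewrite !mxE; case/andP: (ha j) => _ ->; case/andP: (hb j) => ->.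
  move=> y yab; apply: xeO; split=> // i j; rewrite ord1.
  have /= := yab j Logic.I; rewrite !mxE /ball/= ltr_distlC.
  by case/andP: (ha j) (hb j) => [+ _ /andP[_]]; lra.
by apply: bigcup_countType_measurable => ab; case: ifP.
Qed.

Lemma continuous_rV_measurable (f : V -> R) :
  continuous f -> measurable_fun setT f.
Proof.
move=> /continuousP cf; apply: (measurability _ (RGenOpens.measurableE R)).
move=> _ [_ [a [b ->] <-]]; rewrite setTI.
apply: open_rV_measurable; apply: cf; exact: interval_open.
Qed.

(* The partial derivatives are limits of difference quotients. *)
Lemma measurable_grad (f : V -> R) : (forall x, differentiable f x) ->
  measurable_fun setT (grad f).
Proof.
move=> df; have mf : measurable_fun setT f.
  by apply: continuous_rV_measurable => x; exact: differentiable_continuous.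
have cf : continuous f by move=> x; exact: differentiable_continuous.
apply: measurable_fun_rV => j; rewrite /grad.
apply: (@measurable_fun_cvg _ _ _ _
  (fun k x => k.+1%:R * (f (k.+1%:R^-1 *: delta_mx 0 j + x) - f x))).
  move=> k; apply: measurable_funM => //; apply: measurable_funB => //.
  apply: continuous_rV_measurable => x.
  apply: continuous_comp; last exact: cf.
  by apply: continuousD; [exact: cst_continuous|exact: id].
move=> x _; rewrite mxE.
have /cvg_ex[l hl] : cvg ((fun h => h^-1 *: (f (h *: delta_mx 0 j + x) - f x)) @ 0^').
  exact: diff_derivable.
have -> : 'D_(delta_mx 0 j) f x = l by exact: cvg_lim.
(* The derivative is a limit along the punctured neighbourhoods of 0; the steps [1 / (k + 1)] are
   nonzero, so they converge there too. *)
have h0 : k.+1%:R^-1 @[k --> \oo] --> (0 : R)^'.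
  move=> A A0.
  have : \forall k \near \oo, (k.+1%:R^-1 : R) != 0 -> A k.+1%:R^-1.
    exact: @cvg_harmonic R _ A0.
  by apply: filterS => k; apply; rewrite invr_eq0.
under eq_fun do rewrite -[X in X * _]invrK.
exact: cvg_comp h0 hl.
Qed.

Lemma measurable_enorm_sqr : measurable_fun [set: V] (fun u => enorm u ^+ 2).
Proof.
under eq_fun do rewrite enorm_sqr.
by apply: measurable_sum => j; apply: measurable_funM; exact: measurable_coord.
Qed.

Section combinations.
Context d (T : measurableType d).
Implicit Types g h : T -> V.

Lemma measurable_fun_coord g j : measurable_fun setT g ->
  measurable_fun setT (fun t => g t 0 j).
Proof. by move=> mg; exact: measurableT_comp (measurable_coord j) mg. Qed.

Lemma measurable_rVD g h : measurable_fun setT g -> measurable_fun setT h ->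
  measurable_fun setT (fun t => g t + h t).
Proof.
move=> mg mh; apply: measurable_fun_rV => j; under eq_fun do rewrite mxE.
by apply: measurable_funD; exact: measurable_fun_coord.
Qed.

Lemma measurable_rVZ a g : measurable_fun setT g ->
  measurable_fun setT (fun t => a *: g t).
Proof.
move=> mg; apply: measurable_fun_rV => j; under eq_fun do rewrite mxE.
by apply: measurable_funM => //; exact: measurable_fun_coord.
Qed.

Lemma measurable_rVB g h : measurable_fun setT g -> measurable_fun setT h ->
  measurable_fun setT (fun t => g t - h t).
Proof.
move=> mg mh; under eq_fun do rewrite -scaleN1r.
by apply: measurable_rVD => //; exact: measurable_rVZ.
Qed.

Lemma measurable_rV_avg n (g : 'I_n -> T -> V) :
  (forall i, measurable_fun setT (g i)) ->
  measurable_fun setT (fun t => avg (fun i => g i t)).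
Proof.
move=> mg; apply: measurable_fun_rV => j; under eq_fun do rewrite avg_coord.
apply: measurable_funM => //; apply: measurable_sum => i.
exact: measurable_fun_coord.
Qed.

Lemma measurable_avg n (g : 'I_n -> T -> R) :
  (forall i, measurable_fun setT (g i)) ->
  measurable_fun setT (fun t => avg (fun i => g i t : R^o) : R).
Proof. by move=> mg; apply: measurable_funM => //; exact: measurable_sum. Qed.

Lemma measurable_fun_enorm_sqr g : measurable_fun setT g ->
  measurable_fun setT (fun t => enorm (g t) ^+ 2).
Proof. by move=> mg; exact: measurableT_comp measurable_enorm_sqr mg. Qed.

End combinations.
End measurability.

(** * Independence of the past from future draws, and freezing of the past *)

Section independence.
Context {d} {T : measurableType d} {R : realType} (P : probability T R).
Local Open Scope ereal_scope.

(** For a fixed event [E], the sets satisfying the product formula form a Dynkin system, so a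
    generating pi-system suffices. *)
Lemma independent_event_pi_system d' (S : measurableType d') (U : T -> S)
    (G : set (set S)) (E : set T) :
  measurable_fun setT U -> @measurable _ S = <<s G >> -> setI_closed G ->
  measurable E ->
  (forall A, G A -> P (U @^-1` A `&` E) = P (U @^-1` A) * P E) ->
  forall A, measurable A -> P (U @^-1` A `&` E) = P (U @^-1` A) * P E.
Proof.
move=> mU SG GI mE GE A; rewrite SG; move: A.
have mUA A : measurable A -> measurable (U @^-1` A).
  by move=> mA; rewrite -[X in measurable X]setTI; exact: mU.
pose Q A := P (U @^-1` A `&` E) = P (U @^-1` A) * P E.
apply: (@dynkin_induction _ S G Q) => //.
- by rewrite /Q preimage_setT setTI probability_setT mul1e.
- rewrite /Q => A mA AE; rewrite preimage_setC setIC -setDE.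
  rewrite measureD//; [|exact: mUA|by rewrite -ge0_fin_numE// fin_num_measure].
  have PC : P (~` (U @^-1` A)) = 1 - P (U @^-1` A) by exact/probability_setC/mUA.
  rewrite PC (setIC E) [X in _ - X]AE muleBl ?fin_num_measure//.
  by rewrite mul1e.
- rewrite /Q => F mF tF FE; rewrite preimage_bigcup setI_bigcupl.
  have mUF i : measurable (U @^-1` F i) by exact: mUA.
  have tUF : trivIset setT (fun i => U @^-1` F i).
    by move=> i j _ _ [x [Fi Fj]]; apply: tF => //; exists (U x).
  rewrite !measure_bigcup//=.
  + under eq_eseriesr do rewrite FE muleC.
    by rewrite -(fineK (fin_num_measure P E mE)) nneseriesZl// muleC.
  + by move=> i _; exact: measurableI.
  + exact: trivIset_setIr => //.
Qed.

Variables (I : eqType) (F : I -> set (set T)).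
Hypothesis measurable_F : forall i A, F i A -> measurable A.

(** Stated on finite intersections of events of distinct draws, a form that survives induction along
    the run: absorbing a draw [k] into [U] amounts to putting [k] at the head of the list [s]. *)
Definition independent_from (J : pred I) d' (S : measurableType d') (U : T -> S) :=
  forall (s : seq I) (A : I -> set T) (B : set S),
    uniq s -> all J s -> (forall i, i \in s -> F i (A i)) -> measurable B ->
    P (U @^-1` B `&` \bigcap_(i in [set` s]) A i) =
    P (U @^-1` B) * P (\bigcap_(i in [set` s]) A i).

Lemma independent_from_cst J d' (S : measurableType d') (c : S) :
  independent_from J (fun=> c).
Proof.
move=> s A B _ _ _ _; have [Bc|Bc] := pselect (B c).
  rewrite (_ : _ @^-1` _ = setT) ?setTI ?probability_setT ?mul1e//.
  by apply/seteqP; split.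
rewrite (_ : _ @^-1` _ = set0) ?set0I ?measure0 ?mul0e//.
by apply/seteqP; split.
Qed.

Lemma independent_from_comp J d1 d2 (S1 : measurableType d1)
    (S2 : measurableType d2) (U : T -> S1) (g : S1 -> S2) :
  measurable_fun setT g -> independent_from J U -> independent_from J (g \o U).
Proof.
move=> mg UJ s A B us sJ FA mB; rewrite comp_preimage UJ//.
by rewrite -[X in measurable X]setTI; exact: mg.
Qed.

Lemma independent_from_sub (J J' : pred I) d' (S : measurableType d')
    (U : T -> S) : {subset J' <= J} ->
  independent_from J U -> independent_from J' U.
Proof.
by move=> JJ' UJ s A B us sJ'; apply: UJ => //; exact: sub_all sJ'.
Qed.

Section pair.
Context d1 d2 (S1 : measurableType d1) (S2 : measurableType d2).
Variables (U : T -> S1) (Z : {RV P >-> S2}) (J : pred I) (k : I).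
Hypothesis mU : measurable_fun setT U.
Hypothesis Fk : F k = g_sigma_algebra_preimage Z.
Hypothesis Jk : J k.
Hypothesis UJ : independent_from J U.

Lemma independent_from_rectangle (A : set S1) (B : set S2) :
  measurable A -> measurable B ->
  P (U @^-1` A `&` Z @^-1` B) = P (U @^-1` A) * P (Z @^-1` B).
Proof.
move=> mA mB; have := @UJ [:: k] (fun=> Z @^-1` B) A.
rewrite set_cons1 bigcap_set1.
apply => //=; first by rewrite Jk.
by move=> i /[!inE] /eqP ->; rewrite Fk; exists B => //; rewrite setTI.
Qed.

(** On a rectangle, the event on [Z] joins the family as the event of index [k]; the hypothesis on
    [U] applies to [k :: s], and mutual independence then detaches [k] again. Rectangles form a
    pi-system generating the product sigma-algebra. *)
Lemma independent_from_pair : mutually_independent P F ->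
  independent_from [pred i | J i & i != k] (fun w => (U w, Z w)).
Proof.
move=> indF s A B us sJ FA mB.
have kNs : k \notin s by apply/negP => /(allP sJ)/=; rewrite eqxx andbF.
have mE : measurable (\bigcap_(i in [set` s]) A i).
  by apply: fin_bigcap_measurable => // i /= /FA /measurable_F.
apply: (independent_event_pi_system _ (measurable_prod_measurableType S1 S2)) => //.
- exact: measurable_fun_pair.
- move=> _ _ [A1 mA1 [B1 mB1 <-]] [A2 mA2 [B2 mB2 <-]].
  exists (A1 `&` A2); first exact: measurableI.
  by exists (B1 `&` B2); [exact: measurableI|rewrite setXI].
- move=> _ [A1 mA1 [B1 mB1 <-]].
  rewrite [_ @^-1` (A1 `*` B1)](_ : _ = U @^-1` A1 `&` Z @^-1` B1)//.
  (* Since [k] is not in [s], the modified family agrees with [A] on [s]. *)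
  pose A' i := if i == k then Z @^-1` B1 else A i.
  have A'E : \bigcap_(i in [set` k :: s]) A' i =
      Z @^-1` B1 `&` \bigcap_(i in [set` s]) A i.
    rewrite (_ : [set` k :: s] = k |` [set` s]); last first.
      apply/seteqP; split=> i /=; rewrite inE; first by move=> /predU1P.
      by move=> ?; exact/predU1P.
    rewrite bigcap_setU1 /A' eqxx; congr (_ `&` _).
    by apply: eq_bigcapr => i /= si; case: eqVneq si kNs => // -> ->.
  have FA' i : i \in k :: s -> F i (A' i).
    rewrite inE /A'; case: eqVneq => [->|ik /= si]; last exact: FA.
    by rewrite Fk; exists B1 => //; rewrite setTI.
  have usk : uniq (k :: s) by rewrite /= kNs.
  have sJk : all J (k :: s) by rewrite /= Jk; apply: sub_all sJ => i /andP[].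
  rewrite -setIA -A'E UJ// independent_from_rectangle// -muleA; congr (_ * _).
  rewrite (indF _ _ usk FA') (indF _ _ us FA) big_cons /A' eqxx; congr (_ * _).
  by apply: eq_big_seq => i si; case: eqVneq si kNs => // -> ->.
Qed.

(* Freezing the past: U may be held fixed while averaging over Z. *)
Lemma independent_integral (h : S1 * S2 -> \bar R) :
  measurable_fun setT h -> (forall z, 0 <= h z) ->
  \int[P]_w h (U w, Z w) = \int[P]_w \int[P]_w' h (U w, Z w').
Proof.
move=> mh h0.
pose Um : {RV P >-> S1} := HB.pack U (isMeasurableFun.Build _ _ _ _ U mU).
have mUZ : measurable_fun setT (fun w => (U w, Z w)) by exact: measurable_fun_pair.
pose UZ : {RV P >-> (S1 * S2)%type} :=
  HB.pack (fun w => (U w, Z w)) (isMeasurableFun.Build _ _ _ _ _ mUZ).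
rewrite -(ge0_integral_distribution UZ)//.
(* The joint law of [U] and [Z] agrees with the product of their laws on rectangles, hence
   everywhere; Tonelli then gives the iterated integral. *)
rewrite (eq_measure_integral (distribution P Um \x distribution P Z)); last first.
  move=> W mW _; apply/esym; apply: product_measure_unique => //= A B mA mB.
  exact: independent_from_rectangle.
rewrite fubini_tonelli1// ge0_integral_distribution//=; last 2 first.
- exact: measurable_fun_fubini_tonelli_F.
- by move=> x; exact: integral_ge0.
apply: eq_integral => w _; rewrite /fubini_F ge0_integral_distribution//.
exact: measurableT_comp mh _.
Qed.

End pair.
End independence.

Lemma measurable_integral_snd {R : realType} d1 d2 (T1 : measurableType d1)
    (T2 : measurableType d2) (P : probability T2 R) d3 (S : measurableType d3)
    (Z : {RV P >-> S}) (h : T1 * S -> \bar R) :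
  measurable_fun setT h -> (forall z, 0 <= h z)%E ->
  measurable_fun setT (fun x => \int[P]_w h (x, Z w))%E.
Proof.
move=> mh h0; apply: (@measurable_fun_fubini_tonelli_F _ _ _ _ _ P
  (fun z => h (z.1, Z z.2))) => //.
apply: (measurableT_comp mh); apply: measurable_fun_pair => //.
exact: measurableT_comp.
Qed.

(** * Second moments of unbiased perturbations *)

Section second_moment.
Context {R : realType} {m : nat} d (T : measurableType d) (P : probability T R).
Local Notation V := 'rV[R]_m.

(** In the expansion of the square the cross term is linear in the centred vector [Z w - z], so its
    mean vanishes. As it is signed, it must first be shown integrable, which follows from the finite
    second moment. *)
Lemma second_moment_shift (Z : T -> V) (z a : V) (K : R) :
  measurable_fun setT Z -> has_mean P Z z ->
  (\int[P]_w (enorm (Z w - z) ^+ 2)%:E <= K%:E)%E ->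
  (\int[P]_w (enorm (a + (Z w - z)) ^+ 2)%:E <= (enorm a ^+ 2 + K)%:E)%E.
Proof.
move=> mZ Zz ZK.
have mD : measurable_fun setT (fun w => Z w - z) by exact: measurable_rVB.
have iq : P.-integrable setT (fun w => (enorm (Z w - z) ^+ 2)%:E).
  apply/integrableP; split.
    by apply/measurable_EFinP; exact: measurable_fun_enorm_sqr.
  under eq_integral do rewrite gee0_abs ?lee_fin ?sqr_ge0//.
  by rewrite (le_lt_trans ZK) ?ltry.
have iD j : P.-integrable setT (fun w => (Z w 0 j - z 0 j)%:E).
  apply: (@le_integrable _ _ _ _ _ measurableT _
    (fun w => 1%:E + (enorm (Z w - z) ^+ 2)%:E)%E).
  - apply/measurable_EFinP; apply: measurable_funB => //.
    exact: measurable_fun_coord.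
  - move=> w _; rewrite -EFinD /= lee_fin.
    rewrite [X in _ <= X]ger0_norm; last by rewrite addr_ge0 ?sqr_ge0.
    (* Uses [|t| <= 1 + t^2], read off from the squares of [t - 1/2] and [t + 1/2]. *)
    apply: (@le_trans _ _ (1 + (Z w 0 j - z 0 j) ^+ 2)).
      have := sqr_ge0 (Z w 0 j - z 0 j - 2^-1).
      have := sqr_ge0 (Z w 0 j - z 0 j + 2^-1).
      by rewrite ler_norml; set t := _ - z 0 j => ? ?; apply/andP; split; nra.
    rewrite lerD2l enorm_sqr /dotv (bigD1 j)//= !mxE -expr2 lerDl.
    by apply: sumr_ge0 => i _; rewrite -expr2 sqr_ge0.
  - by apply: integrableD => //; exact: finite_measure_integrable_cst.
have D0 j : (\int[P]_w (Z w 0 j - z 0 j)%:E = 0)%E.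
  have := Zz j; rewrite unlock.
  under eq_integral do rewrite -[Z _ _ _](subrK (z 0 j)) EFinD.
  rewrite integralD//; last exact: finite_measure_integrable_cst.
  rewrite integral_cst// [X in (_ * X)%E](probability_setT P) mule1.
  rewrite -(fineK (integrable_fin_num _ (iD j)))//= -EFinD => -[h].
  by congr EFin; apply: (addIr (z 0 j)); rewrite add0r.
under eq_integral do rewrite enorm_sqrD 2!EFinD.
have iC : P.-integrable setT (fun w => (2 * dotv a (Z w - z))%:E).
  have -> : (fun w => (2 * dotv a (Z w - z))%:E) =
      fun w => (\sum_j (2 * a 0 j)%:E * (Z w 0 j - z 0 j)%:E)%E.
    apply/funext => w; rewrite sumEFin mulr_sumr; congr EFin.
    by apply: eq_bigr => j _; rewrite !mxE mulrA.
  by apply: integrable_sum => // j _; exact: integrableZl.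
rewrite integralD//; last first.
  by apply: integrableD => //; exact: finite_measure_integrable_cst.
rewrite integralD//; last exact: finite_measure_integrable_cst.
rewrite integral_cst// [X in (_ * X)%E](probability_setT P) mule1.
rewrite (_ : \int[P]_x (2 * dotv _ _)%:E = 0)%E.
  by rewrite adde0 EFinD leeD2l.
under eq_integral => w _.
  rewrite (_ : _%:E = (\sum_j (2 * a 0 j)%:E * (Z w 0 j - z 0 j)%:E)%E); last first.
    rewrite sumEFin mulr_sumr; congr EFin.
    by apply: eq_bigr => j _; rewrite !mxE mulrA.
  over.
rewrite integral_sum//; last by move=> j; exact: integrableZl.
by rewrite big1// => j _; rewrite integralZl// D0 mule0.
Qed.

End second_moment.

(** The integral is the difference of those of the positive and negative parts, and an extended-real
    difference is finite only if both terms are. Thus [has_mean] carries integrability with it. *)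
Lemma integrable_fin_num_integral {R : realType} d (T : measurableType d)
    (mu : {measure set T -> \bar R}) (g : T -> \bar R) :
  measurable_fun setT g -> (\int[mu]_w g w)%E \is a fin_num ->
  mu.-integrable setT g.
Proof.
move=> mg; rewrite integralE fin_numB => /andP[fp fn].
apply/integrableP; split => //.
have -> : (fun x => `|g x|)%E = (g^\+ \+ g^\-)%E by rewrite -fune_abse.
rewrite ge0_integralD//; last 2 first.
- exact: measurable_funepos.
- exact: measurable_funeneg.
by rewrite lte_add_pinfty// -ge0_fin_numE// integral_ge0.
Qed.

Lemma has_mean_avg {R : realType} {m n : nat} d (T : measurableType d)
    (P : probability T R) (Z : 'I_n -> T -> 'rV[R]_m) (z : 'rV[R]_m) :
  (0 < n)%N -> (forall i, measurable_fun setT (Z i)) ->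
  (forall i, has_mean P (Z i) z) -> has_mean P (fun w => avg (Z ^~ w)) z.
Proof.
move=> n0 mZ Zz j; have iZ i : P.-integrable setT (fun w => (Z i w 0 j)%:E).
  apply: integrable_fin_num_integral.
    by apply/measurable_EFinP; exact: measurable_fun_coord.
  by have := Zz i j; rewrite unlock => ->.
rewrite unlock; under eq_integral do rewrite avg_coord EFinM -sumEFin.
rewrite integralZl//; last exact: integrable_sum.
rewrite integral_sum//; under eq_bigr => i _.
  have := Zz i j; rewrite unlock => ->; over.
rewrite sumEFin sumr_const card_ord -EFinM -[z 0 j *+ n]mulr_natl; congr EFin.
by rewrite mulrA mulVf ?mul1r// pnatr_eq0 -lt0n.
Qed.

(** * One random round: expected drift and expected decrease *)

Section one_round.
Context {R : realType} {m n : nat} d (Omega : measurableType d)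
  (P : probability Omega R) d' (S : measurableType d').
Local Notation V := 'rV[R]_m.
Variables (f_ : 'I_n -> V -> R) (L LA LB fstar gamma p omega theta : R).
Let f (x : V) : R := avg (fun i => f_ i x : R^o).
Hypothesis n_gt0 : (0 < n)%N.
Hypothesis df : forall i x, differentiable (f_ i) x.
Hypothesis smooth_f : smooth L f.
Hypothesis f_lb : forall x, fstar <= f x.
Hypothesis functional : functional_inequality LA LB f_.
Hypothesis gamma_gt0 : 0 < gamma.
Hypothesis p01 : 0 < p <= 1.
Hypothesis step : (gamma%:E <= 1 / (L +
  Num.sqrt ((LA ^+ 2 * omega + LB ^+ 2 * theta) * (1 / p - 1)))%:E)%E.

(* The workers' models are stored as a tuple, whose sigma-algebra is the
   product one. *)
Definition state : Type := (V * n.-tuple V)%type.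

Definition unpack (y : state) : V * ('I_n -> V) := (y.1, tnth y.2).

Definition pack (xw : V * ('I_n -> V)) : state := (xw.1, [tuple xw.2 i | i < n]).

Lemma packK : cancel pack unpack.
Proof. by case=> x w; congr pair; apply/funext => i; rewrite /= tnth_mktuple. Qed.

Definition potential (y : state) : R :=
  lyapunov f_ gamma fstar LA LB p (unpack y).

Variables (xi : {RV P >-> S}) (Q : 'I_n -> S -> V -> V).
Hypothesis mQ : forall i, measurable_fun [set: S * V] (fun z => Q i z.1 z.2).

(** The argument is nested as state, then compressor seed, then coin, so that the two draws can be
    adjoined to the past one after the other by [independent_from_pair]. *)
Definition next_state (z : state * S * bool) : state :=
  let y := z.1.1 in let x' := next_x f_ gamma (unpack y) in
  (x', [tuple if z.2 then x' else tnth y.2 i + Q i z.1.2 (x' - y.1) | i < n]).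

Lemma unpack_next_state y s c : unpack (next_state (y, s, c)) =
  (next_x f_ gamma (unpack y), fun i => if c then next_x f_ gamma (unpack y)
    else tnth y.2 i + Q i s (next_x f_ gamma (unpack y) - y.1)).
Proof. exact: packK (_, _). Qed.

Lemma next_state_pack (x : V) (w : 'I_n -> V) s c :
  next_state (pack (x, w), s, c) = pack (next_x f_ gamma (x, w),
    fun i => if c then next_x f_ gamma (x, w)
             else w i + Q i s (next_x f_ gamma (x, w) - x)).
Proof.
rewrite /next_state [unpack _]packK; congr pair.
by apply: eq_mktuple => i; rewrite tnth_mktuple.
Qed.

Lemma measurable_next_x : measurable_fun setT (fun y : state => next_x f_ gamma (unpack y)).
Proof.
apply: measurable_rVB; first exact: measurable_fst.
apply: measurable_rVZ; apply: measurable_rV_avg => i.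
apply: (measurableT_comp (measurable_grad (df i))).
exact: measurableT_comp (measurable_tnth i) measurable_snd.
Qed.

Lemma measurable_next_state : measurable_fun setT next_state.
Proof.
have m1 : measurable_fun setT (fun z : state * S * bool => z.1.1).
  exact: measurableT_comp measurable_fst measurable_fst.
have mx : measurable_fun setT (fun z : state * S * bool => next_x f_ gamma (unpack z.1.1)).
  exact: measurableT_comp measurable_next_x m1.
apply: measurable_fun_pair => //; apply/measurable_fun_tnthP => i.
rewrite (_ : _ \o _ = fun z => if z.2 then next_x f_ gamma (unpack z.1.1) else
  tnth z.1.1.2 i + Q i z.1.2 (next_x f_ gamma (unpack z.1.1) - z.1.1.1)); last first.
  by apply/funext => z; rewrite /= tnth_mktuple.
apply: measurable_fun_ifT => //; apply: measurable_rVD.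
  apply: (measurableT_comp (measurable_tnth i)).
  exact: measurableT_comp measurable_snd m1.
apply: (measurableT_comp (mQ i) (g := fun z : state * S * bool =>
  (z.1.2, next_x f_ gamma (unpack z.1.1) - z.1.1.1))).
apply: measurable_fun_pair.
  exact: measurableT_comp measurable_snd measurable_fst.
apply: measurable_rVB => //.
exact: measurableT_comp measurable_fst m1.
Qed.

Lemma measurable_potential : measurable_fun setT potential.
Proof.
have mt i : measurable_fun setT (fun y : state => tnth y.2 i).
  exact: measurableT_comp (measurable_tnth i) measurable_snd.
have mx : measurable_fun setT (fun y : state => y.1) by exact: measurable_fst.
have mf i : measurable_fun setT (f_ i).
  by apply: continuous_rV_measurable => x; exact: differentiable_continuous.
rewrite /potential /lyapunov/=.
apply: measurable_funD; [apply: measurable_funD|].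
- apply: measurable_funB => //; apply: measurable_avg => i.
  exact: measurableT_comp (mf i) mx.
- apply: measurable_funM => //; apply: measurable_avg => i.
  by apply: measurable_fun_enorm_sqr; exact: measurable_rVB.
- apply: measurable_funM => //; apply: measurable_fun_enorm_sqr.
  by apply: measurable_rVB => //; exact: measurable_rV_avg.
Qed.

Lemma drift_ge0 (xw : V * ('I_n -> V)) : 0 <= drift LA LB xw.
Proof.
by rewrite addr_ge0// mulr_ge0 ?sqr_ge0//; apply: avg_ge0 => i; rewrite sqr_ge0.
Qed.

Lemma lyapunov_ge0 (xw : V * ('I_n -> V)) : 0 <= lyapunov f_ gamma fstar LA LB p xw.
Proof.
rewrite lyapunovE addr_ge0 ?subr_ge0 ?f_lb//.
have [p0 _] := andP p01.
by rewrite mulr_ge0 ?drift_ge0// divr_ge0 ?mulr_ge0// ltW.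
Qed.

Hypothesis hU : forall i, compressor_U P omega (fun w => Q i (xi w)).
Hypothesis hP : compressors_P P theta (fun i w => Q i (xi w)).

(** Since [(w_i + C_i v) - (x + v) = (w_i - x) + (C_i v - v)], each deviation is shifted by a
    centred vector. [second_moment_shift] applies with the individual variance [omega] for each
    worker and with the collective variance [theta] for the average. *)
Lemma expected_drift (y : state) (v : V) :
  (\int[P]_w (drift LA LB (y.1 + v, fun i => tnth y.2 i + Q i (xi w) v))%:E <=
   (drift LA LB (unpack y) +
    (LA ^+ 2 * omega + LB ^+ 2 * theta) * enorm v ^+ 2)%:E)%E.
Proof.
have mC i : measurable_fun setT (fun w => Q i (xi w) v).
  apply: (measurableT_comp (mQ i) (g := fun w => (xi w, v))).
  exact: measurable_fun_pair.
pose a i := tnth y.2 i - y.1; pose Z i w := Q i (xi w) v - v.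
have driftE w : drift LA LB (y.1 + v, fun i => tnth y.2 i + Q i (xi w) v) =
    \sum_i LA ^+ 2 / n%:R * enorm (a i + Z i w) ^+ 2 +
    LB ^+ 2 * enorm (avg a + (avg (fun i => Q i (xi w) v) - v)) ^+ 2.
  have -> : avg a = avg (tnth y.2) - y.1 by rewrite /a avgB avg_cst.
  rewrite /drift/= (avgD (tnth y.2)) addrACA -opprD; congr (_ + _).
  rewrite -mulr_sumr -mulrA; congr (_ * (_ * _)); apply: eq_bigr => i _.
  by rewrite /a /Z addrACA -opprD.
have step1 i : (\int[P]_w (enorm (a i + Z i w) ^+ 2)%:E <=
    (enorm (a i) ^+ 2 + omega * enorm v ^+ 2)%:E)%E.
  have [mean var] := hU i v; apply: second_moment_shift => //.
  by move: var; rewrite unlock.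
have mavg : measurable_fun setT (fun w => avg (fun i => Q i (xi w) v)).
  exact: measurable_rV_avg.
have step2 : (\int[P]_w (enorm (avg a + (avg (fun i => Q i (xi w) v) - v)) ^+ 2)%:E <=
    (enorm (avg a) ^+ 2 + theta * enorm v ^+ 2)%:E)%E.
  have [mean var] := hP v; apply: second_moment_shift => //.
    exact: has_mean_avg.
  by move: var; rewrite unlock.
have mZ i : measurable_fun setT (fun w => (enorm (a i + Z i w) ^+ 2)%:E).
  apply/measurable_EFinP; apply: measurable_fun_enorm_sqr.
  by apply: measurable_rVD => //; exact: measurable_rVB.
have mavgZ : measurable_fun setT
    (fun w => (enorm (avg a + (avg (fun i => Q i (xi w) v) - v)) ^+ 2)%:E).
  apply/measurable_EFinP; apply: measurable_fun_enorm_sqr.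
  by apply: measurable_rVD => //; exact: measurable_rVB.
have LAn : 0 <= LA ^+ 2 / n%:R by rewrite divr_ge0 ?sqr_ge0.
under eq_integral.
  move=> w _; rewrite driftE EFinD -sumEFin EFinM.
  under eq_bigr do rewrite EFinM.
  over.
rewrite ge0_integralD//; last 4 first.
- by move=> w _; apply: sume_ge0 => i _; rewrite mule_ge0// lee_fin sqr_ge0.
- by apply: emeasurable_sum => i; exact: measurable_funeM.
- by move=> w _; rewrite mule_ge0// lee_fin sqr_ge0.
- exact: measurable_funeM.
rewrite ge0_integral_sum//; last 2 first.
- by move=> i; exact: measurable_funeM.
- by move=> i w _; rewrite mule_ge0// lee_fin sqr_ge0.
rewrite ge0_integralZl//; last 2 first.
- by move=> w _; rewrite lee_fin sqr_ge0.
- by rewrite lee_fin sqr_ge0.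
have -> : drift LA LB (unpack y) + (LA ^+ 2 * omega + LB ^+ 2 * theta) * enorm v ^+ 2 =
    \sum_i LA ^+ 2 / n%:R * (enorm (a i) ^+ 2 + omega * enorm v ^+ 2) +
    LB ^+ 2 * (enorm (avg a) ^+ 2 + theta * enorm v ^+ 2).
  rewrite -mulr_sumr big_split/= sumr_const card_ord -[_ * _ *+ n]mulr_natl.
  have -> : avg a = avg (tnth y.2) - y.1 by rewrite /a avgB avg_cst.
  rewrite /drift/= /avg /GRing.scale/= -/(avg _).
  by field; rewrite pnatr_eq0 -lt0n.
rewrite EFinD leeD//; last first.
  by rewrite [X in (_ <= X)%E]EFinM lee_wpmul2l// lee_fin sqr_ge0.
rewrite -sumEFin lee_sum// => i _; rewrite [X in (_ <= X)%E]EFinM ge0_integralZl//.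
- by rewrite lee_wpmul2l.
- by move=> w _; rewrite lee_fin sqr_ge0.
Qed.

(** For a fixed state the only quantity depending on the seed is the drift of the compressed branch,
    so the integrand is [a + b * drift] with [a] and [b] nonnegative constants. *)
Lemma expected_potential (y : state) :
  (\int[P]_w (p * potential (next_state (y, xi w, true)) +
     (1 - p) * potential (next_state (y, xi w, false)))%:E +
   (gamma / 2 * enorm (grad f y.1) ^+ 2)%:E <= (potential y)%:E)%E.
Proof.
have [p0 p1] := andP p01; have p1' : 0 <= 1 - p by rewrite subr_ge0.
have := lyapunov_step_bound fstar n_gt0 df smooth_f functional gamma_gt0 p01 step (unpack y).
rewrite -[lyapunov _ _ _ _ _ _ (unpack y)]/(potential y).
set x' := next_x _ _ _; set v := x' - (unpack y).1 => key.
have mC i : measurable_fun setT (fun w => Q i (xi w) v).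
  apply: (measurableT_comp (mQ i) (g := fun w => (xi w, v))).
  exact: measurable_fun_pair.
pose b := (1 - p) * (gamma / (2 * p)).
have b0 : 0 <= b by rewrite mulr_ge0// divr_ge0 ?mulr_ge0// ltW.
pose a := p * lyapunov f_ gamma fstar LA LB p (x', fun=> x') + (1 - p) * (f x' - fstar).
have a0 : 0 <= a by rewrite addr_ge0// mulr_ge0 ?lyapunov_ge0 ?subr_ge0 ?f_lb// ltW.
have E w : p * potential (next_state (y, xi w, true)) +
     (1 - p) * potential (next_state (y, xi w, false)) =
   a + b * drift LA LB (y.1 + v, fun i => tnth y.2 i + Q i (xi w) v).
  rewrite /potential !unpack_next_state.
  have -> : y.1 + v = x' by rewrite /v addrC subrK.
  by rewrite /a /b !lyapunovE -/x' -/v -/f; ring.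
have mdrift : measurable_fun setT
    (fun w => (drift LA LB (y.1 + v, fun i => tnth y.2 i + Q i (xi w) v))%:E).
  apply/measurable_EFinP; rewrite /drift/=.
  have mwC i : measurable_fun setT (fun w => tnth y.2 i + Q i (xi w) v).
    exact: measurable_rVD.
  apply: measurable_funD; apply: measurable_funM => //.
    apply: measurable_avg => i; apply: measurable_fun_enorm_sqr.
    exact: measurable_rVB.
  apply: measurable_fun_enorm_sqr; apply: measurable_rVB => //.
  exact: measurable_rV_avg.
under eq_integral do rewrite E EFinD EFinM.
rewrite ge0_integralD//; last 2 first.
- by move=> w _; rewrite mule_ge0// lee_fin drift_ge0.
- exact: measurable_funeM.
rewrite integral_cst// [X in (_ * X)%E](probability_setT P) mule1.
rewrite ge0_integralZl//; last by move=> w _; rewrite lee_fin drift_ge0.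
have /(lee_wpmul2l (x := b%:E)) := expected_drift y v.
rewrite lee_fin => /(_ b0)/(leeD2l a%:E)/(leeD2r (gamma / 2 * enorm (grad f y.1) ^+ 2)%:E).
move=> /le_trans; apply; rewrite -EFinM -!EFinD lee_fin (le_trans _ key)// /a /b.
by rewrite lerD2r -addrA lerD2l le_eqVlt; apply/orP; left; apply/eqP; ring.
Qed.

Variables (I : eqType) (F : I -> set (set Omega)) (J : pred I) (kx kc : I).
Variables (c : {RV P >-> bool}) (U : Omega -> state).
Hypothesis measurable_F : forall i A, F i A -> measurable A.
Hypothesis indF : mutually_independent P F.
Hypothesis Fx : F kx = g_sigma_algebra_preimage xi.
Hypothesis Fc : F kc = g_sigma_algebra_preimage c.
Hypothesis kxc : kc != kx.
Hypotheses (Jx : J kx) (Jc : J kc).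
Hypothesis mU : measurable_fun setT U.
Hypothesis UJ : independent_from P F J U.
Hypothesis coin : forall A, distribution P c A = bernoulli_prob p A.

Let UX w := (U w, xi w).

Let mUX : measurable_fun setT UX.
Proof. exact: measurable_fun_pair. Qed.

Let UXJ : independent_from P F [pred i | J i & i != kx] UX.
Proof. exact: independent_from_pair. Qed.

Lemma measurable_round : measurable_fun setT (fun w => next_state (U w, xi w, c w)).
Proof.
apply: (measurableT_comp measurable_next_state).
by apply: measurable_fun_pair.
Qed.

(** The new state is a measurable function of the old one and the two draws; adjoining each draw
    removes its index from those still independent. *)
Lemma independent_from_round :
  independent_from P F [pred i | (J i && (i != kx)) && (i != kc)]
    (fun w => next_state (U w, xi w, c w)).
Proof.
apply: (independent_from_comp (U := fun w => (UX w, c w)) measurable_next_state).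
by apply: (independent_from_pair measurable_F mUX Fc) => //=; rewrite Jc.
Qed.

(** The coin is averaged with state and seed frozen, then the seed with the state frozen;
    [expected_potential] is finally integrated over the state. *)
Lemma round_descent :
  (\int[P]_w (potential (next_state (U w, xi w, c w)))%:E +
   \int[P]_w (gamma / 2 * enorm (grad f (U w).1) ^+ 2)%:E <=
   \int[P]_w (potential (U w))%:E)%E.
Proof.
have p01' : 0 <= p <= 1 by have [p0 p1] := andP p01; rewrite ltW.
have pot0 y : (0 <= (potential y)%:E)%E by rewrite lee_fin lyapunov_ge0.
have mpot : measurable_fun setT (fun z => (potential (next_state z))%:E).
  apply/measurable_EFinP.
  exact: measurableT_comp measurable_potential measurable_next_state.
have mgrad : measurable_fun setT (fun y : state => (gamma / 2 * enorm (grad f y.1) ^+ 2)%:E).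
  apply/measurable_EFinP; apply: measurable_funM => //.
  apply: measurable_fun_enorm_sqr; apply: measurableT_comp (measurable_grad _) _.
    by move=> x; exact: differentiable_avg.
  exact: measurable_fst.
pose h (z : state * S) := (p * potential (next_state (z, true)) +
     (1 - p) * potential (next_state (z, false)))%:E.
have h0 z : (0 <= h z)%E.
  by rewrite lee_fin addr_ge0// mulr_ge0 ?lyapunov_ge0//; case/andP: p01' => //; lra.
have mh : measurable_fun setT h.
  have mz b : measurable_fun setT (fun z : state * S => potential (next_state (z, b))).
    apply: (measurableT_comp measurable_potential).
    by apply: (measurableT_comp measurable_next_state); exact: measurable_fun_pair.
  by apply/measurable_EFinP; apply: measurable_funD; apply: measurable_funM.
rewrite (independent_integral (U := UX) (Z := c) mUX Fc _ UXJ mpot); last 2 first.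
- by rewrite /= Jc.
- by [].
have -> : (\int[P]_w \int[P]_w' (potential (next_state (UX w, c w')))%:E =
    \int[P]_w h (UX w))%E.
  apply: eq_integral => w _.
  (* Passing to the law of the coin turns the inner integral into the two-term Bernoulli average. *)
  rewrite -(ge0_integral_distribution c
    (f := fun b => (potential (next_state (UX w, b)))%:E))//.
  rewrite (eq_measure_integral (bernoulli_prob p)) => [|A _ _]; last exact: coin.
  by rewrite integral_bernoulli_prob// -!EFinM -EFinD.
(* Second freezing, now for the seed. *)
rewrite (independent_integral mU Fx Jx UJ mh)// -ge0_integralD//.
- apply: ge0_le_integral => //.
  + by move=> w _; rewrite adde_ge0 ?integral_ge0// lee_fin mulr_ge0 ?sqr_ge0// divr_ge0// ltW.
  + apply: emeasurable_funD; last exact: measurableT_comp mgrad mU.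
    exact: measurableT_comp (measurable_integral_snd (P := P) xi mh h0) mU.
  + by apply/measurable_EFinP; exact: measurableT_comp measurable_potential mU.
  + by move=> w _; exact: expected_potential.
- by move=> w _; exact: integral_ge0.
- exact: measurableT_comp (measurable_integral_snd (P := P) xi mh h0) mU.
- by move=> w _; rewrite lee_fin mulr_ge0 ?sqr_ge0// divr_ge0// ltW.
- exact: measurableT_comp mgrad mU.
Qed.

End one_round.

(** * Induction along the run and telescoping *)

Theorem theoremD1 (R : realType) (m n : nat) (hn : (0 < n)%N)
  (f_ : 'I_n -> 'rV[R]_m -> R) (f : 'rV[R]_m -> R)
  (hf_ : forall i x, differentiable (f_ i) x)
  (hf : f = fun x => avg (fun i => f_ i x : R^o))
  (L LA LB fstar : R)
  (hL : smooth L f)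
  (hfstar : forall x, fstar <= f x)
  (hLA : 0 <= LA) (hLB : 0 <= LB)
  (hAB : functional_inequality LA LB f_)
  (d : measure_display) (Omega : measurableType d) (P : probability Omega R)
  (dS : nat -> measure_display) (S : forall t, measurableType (dS t))
  (xi : forall t, {RV P >-> S t})
  (C : nat -> 'I_n -> Omega -> 'rV[R]_m -> 'rV[R]_m)
  (hC : forall t i, random_mapping (xi t) (C t i))
  (theta omegaP : R)
  (hP : forall t, compressors_P P theta (C t))
  (hU : forall t i, compressor_U P omegaP (C t i))
  (p : R) (hp : 0 < p <= 1)
  (c : nat -> {RV P >-> bool})
  (hc : forall t A, distribution P (c t) A = bernoulli_prob p A)
  (hindep : mutually_independent P (fun k : nat + nat => match k with
     | inl t => g_sigma_algebra_preimage (xi t)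
     | inr t => g_sigma_algebra_preimage (c t)
     end))
  (gamma : R) (hgamma : 0 < gamma)
  (hstep : (gamma%:E <=
     1 / (L + Num.sqrt ((LA ^+ 2 * omegaP + LB ^+ 2 * theta) * (1 / p - 1)))%:E)%E)
  (x0 : 'rV[R]_m) (w0 : 'I_n -> 'rV[R]_m)
  (run : nat -> Omega -> 'rV[R]_m * ('I_n -> 'rV[R]_m))
  (hrun : forall t w,
     run t w = marinaP f_ gamma x0 w0 (fun s i => C s i w) (fun s => c s w) t)
  (T : nat) (hT : (0 < T)%N) :
  ((T%:R^-1)%:E * \sum_(0 <= t < T) 'E_P[fun w => (enorm (grad f (run t w).1) ^+ 2)%R]
     <= (2 * lyapunov f_ gamma fstar LA LB p (x0, w0) / (gamma * T%:R))%:E)%E.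
Proof.
subst f; set f := (fun x => avg _) in hL hfstar *.
have p01 : 0 <= p <= 1 by have [p0 p1] := andP hp; rewrite ltW.
have g0 : 0 <= gamma / 2 by rewrite divr_ge0// ltW.
pose F (k : nat + nat) := match k with
  | inl t => g_sigma_algebra_preimage (xi t)
  | inr t => g_sigma_algebra_preimage (c t)
  end.
have mF k A : F k A -> measurable A.
  by case: k => t [B mB <-]; exact: measurable_funPT.
(* The draws of rounds [t] and later, none of which has influenced the state at time [t]. *)
pose J (t : nat) : pred (nat + nat) := fun k => match k with inl s | inr s => (t <= s)%N end.
have exQ t : exists Q : 'I_n -> S t -> 'rV[R]_m -> 'rV[R]_m,
    (forall i, measurable_fun [set: S t * 'rV[R]_m] (fun z => Q i z.1 z.2)) /\
    (forall i w v, C t i w v = Q i (xi t w) v).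
  have /choice[Q hQ] i : exists Q : S t -> 'rV[R]_m -> 'rV[R]_m,
      measurable_fun [set: S t * 'rV[R]_m] (fun z => Q z.1 z.2) /\
      forall w v, C t i w v = Q (xi t w) v.
    by have [Q mQ QE] := hC t i; exists Q.
  by exists Q; split => i; have [] := hQ i.
have [Q hQ] : exists Q : forall t, 'I_n -> S t -> 'rV[R]_m -> 'rV[R]_m, forall t,
    (forall i, measurable_fun [set: S t * 'rV[R]_m] (fun z => Q t i z.1 z.2)) /\
    (forall i w v, C t i w v = Q t i (xi t w) v).
  (* The type of the witness depends on [t] through [S t], hence [cid] in place of [choice]. *)
  by exists (fun t => sval (cid (exQ t))) => t; exact: svalP (cid (exQ t)).
have CE t : (fun i w => Q t i (xi t w)) = C t.
  by apply/funext => i; apply/funext => w; apply/funext => v; rewrite (hQ t).2.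
pose Y t w : state := pack (run t w).
have Y0 : Y 0%N = fun=> pack (x0, w0).
  by apply/funext => w; rewrite /Y hrun.
have YS t : Y t.+1 = fun w => next_state f_ gamma (Q t) (Y t w, xi t w, c t w).
  apply/funext => w; rewrite /Y !hrun /=; case: marinaP => x v.
  rewrite next_state_pack; congr pack; congr pair; apply/funext => i.
  by rewrite (hQ t).2.
have mQ t := (hQ t).1.
have Yprop t : measurable_fun setT (Y t) /\ independent_from P F (J t) (Y t).
  elim: t => [|t [mY YJ]].
    by rewrite Y0; split => //; exact: independent_from_cst.
  rewrite YS; split; first exact: measurable_round.
  apply: independent_from_sub; last first.
    exact: (independent_from_round gamma hf_ (mQ t) (F := F) (J := J t)
      (kx := inl t) (kc := inr t) mF hindep erefl erefl isT (leqnn t) (leqnn t) mY YJ).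
  (* A draw of a round after [t] lies in [J t] and is neither of the two draws just consumed. *)
  have lt_neq s : (t < s)%N -> (t <= s)%N && (s != t).
    by move=> ts; rewrite ltnW// neq_ltn ts orbT.
  by move=> [] s /lt_neq /andP[ts sNt]; rewrite !inE /= ts sNt.
pose e t := (\int[P]_w (potential f_ LA LB fstar gamma p (Y t w))%:E)%E.
pose g t := ('E_P[fun w => (enorm (grad f (run t w).1) ^+ 2)%R])%E.
have descent_t t : (e t.+1 + (gamma / 2)%:E * g t <= e t)%E.
  have [mY YJ] := Yprop t.
  have U' i : compressor_U P omegaP (fun w => Q t i (xi t w)).
    by have := hU t i; rewrite -CE.
  have P' : compressors_P P theta (fun i w => Q t i (xi t w)) by rewrite CE.
  have := round_descent hn hf_ hL hfstar hAB hgamma hp hstep (mQ t) U' P'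
    (F := F) (J := J t) (kx := inl t) (kc := inr t) mF hindep erefl erefl
    isT (leqnn t) (leqnn t) mY YJ (hc t).
  suff -> : ((gamma / 2)%:E * g t =
      \int[P]_w (gamma / 2 * enorm (grad f (Y t w).1) ^+ 2)%:E)%E by rewrite /e YS.
  under eq_integral do rewrite EFinM.
  rewrite ge0_integralZl ?lee_fin//.
  - by rewrite /g unlock.
  - apply/measurable_EFinP; apply: measurable_fun_enorm_sqr.
    apply: (measurableT_comp (measurable_grad _)).
      by move=> x; exact: differentiable_avg.
    exact: measurableT_comp measurable_fst mY.
  - by move=> w _; rewrite lee_fin sqr_ge0.
have e0 : e 0%N = (lyapunov f_ gamma fstar LA LB p (x0, w0))%:E.
  rewrite /e Y0 integral_cst// [X in (_ * X)%E](probability_setT P) mule1.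
  by rewrite /potential packK.
(* The telescoped sum, kept in additive form to avoid subtracting extended reals. *)
have eN t : (e t + (gamma / 2)%:E * \sum_(0 <= s < t) g s <= e 0%N)%E.
  elim: t => [|t IH]; first by rewrite big_nil mule0 adde0.
  rewrite big_nat_recr//= ge0_muleDr; last 2 first.
  - by apply: sume_ge0 => s _; apply: expectation_ge0 => w; exact: sqr_ge0.
  - by apply: expectation_ge0 => w; exact: sqr_ge0.
  apply: le_trans IH; rewrite addeA addeAC leeD2r//.
have eT0 : (0 <= e T)%E.
  by apply: integral_ge0 => w _; rewrite lee_fin lyapunov_ge0.
(* Drop [e T], which is nonnegative; it remains to divide by [gamma / 2] and by [T]. *)
have := le_trans (leeDr _ eT0) (eN T).
rewrite e0 -lee_pdivlMl ?divr_gt0// -EFinM.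
move=> /(lee_wpmul2l (x := (T%:R^-1)%:E)); rewrite lee_fin invr_ge0 ler0n => /(_ isT).
rewrite -EFinM => /le_trans; apply; rewrite lee_fin le_eqVlt; apply/orP; left.
by apply/eqP; field; rewrite pnatr_eq0 -lt0n hT gt_eqF.
Qed.
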